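(* Let $n\ge 2$, let $W$ be a conference matrix of order $n$, and let $k$ be an odd integer such that $k\le \sqrt{n-1}<k+2$. Then $$E(W)\le \frac{n(k^2+2k+n-1)}{2(k+1)},$$ with equality if and only if one of the following holds: (i) $n-1$ is a perfect square and $W\mathbf{1}_n=k\mathbf{1}_n$; or (ii) $n-1$ is not a perfect square and the set of entries of the vector $W\mathbf{1}_n$ is exactly $\{k,k+2\}$ (i.e. every entry is $k$ or $k+2$, and both values occur).
   Context: A conference matrix of order $n$ is an $n\times n$ matrix $W$ with entries in $\{0,-1,1\}$ and zero diagonal satisfying $WW^T=(n-1)I$, where $I$ is the $n\times n$ identity matrix. The excess $E(W)$ is the sum of all entries of $W$. $\mathbf{1}_n$ denotes the all-one column vector of length $n$. *)

(* Defs.v *)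
From mathcomp Require Import all_boot all_order all_algebra.

Set Implicit Arguments.
Unset Strict Implicit.
Unset Printing Implicit Defensive.

Import Order.TTheory GRing.Theory Num.Theory.
Local Open Scope ring_scope.

Definition conference_matrix (n : nat) (W : 'M[int]_n) : Prop :=
  [/\ forall i j, W i j \in [:: 0; -1; 1],
      forall i, W i i = 0
    & W *m W^T = (n%:Z - 1)%:M].

Definition excess (n : nat) (W : 'M[int]_n) : int :=
  \sum_(i < n) \sum_(j < n) W i j.

Definition ones (n : nat) : 'cV[int]_n := const_mx 1.

Definition perfect_square (m : nat) : Prop := exists r : nat, m = (r ^ 2)%N.

(* Main.v *)
(** The row sums [s_i] of [W] are odd, because the order of a conference matrix
    is even, and [\sum_i s_i ^ 2 = n (n - 1)], because [W^T W = (n - 1) I] as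
    well.  No odd integer lies strictly between [k] and [k + 2], so
    [(s_i - k) (s_i - k - 2) >= 0]; summing over [i] gives the bound, with
    equality iff every [s_i] is [k] or [k + 2].  If [n - 1] is a square, its
    root is odd, hence equal to [k], and the sum of squares forces every
    [s_i] to be [k]; otherwise neither value can be taken by all the [s_i]. *)
Require Import Defs.
From mathcomp Require Import all_boot all_order all_algebra.
From mathcomp Require Import zify ring lra.

Set Implicit Arguments.
Unset Strict Implicit.
Unset Printing Implicit Defensive.

Import Order.TTheory GRing.Theory Num.Theory.
Local Open Scope ring_scope.

(** [A] need not be invertible over a domain, so the adjugate replaces the inverse: [A] kills
    [A^T *m A - c%:M], hence [\det A] does too, and [\det A] is nonzero because [c ^+ n] is. *)
Lemma trmx_mulmx_scalar (R : idomainType) (n : nat) (A : 'M[R]_n) (c : R) :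
  c != 0 -> A *m A^T = c%:M -> A^T *m A = c%:M.
Proof.
move=> c0 AAT.
have detA : \det A != 0.
  apply: contraNneq c0 => detA0; have := congr1 determinant AAT.
  rewrite det_mulmx detA0 mul0r det_scalar => /esym/eqP.
  by rewrite expf_eq0 => /andP[].
apply/eqP; rewrite -subr_eq0; set X := _ - _.
have AX : A *m X = 0.
  by rewrite mulmxBr mulmxA AAT scalar_mxC subrr.
have /eqP : \det A *: X = 0.
  by rewrite -mul_scalar_mx -mul_adj_mx -mulmxA AX mulmx0.
by rewrite scalemx_eq0 (negPf detA).
Qed.

Lemma psumr_le_eq (R : numDomainType) (I : finType) (F G : I -> R) :
  (forall i, F i <= G i) -> \sum_i F i = \sum_i G i -> forall i, F i = G i.
Proof.
move=> leFG eqFG i; apply/esym/eqP; rewrite -subr_eq0; apply/eqP.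
have ge0 j : true -> 0 <= G j - F j by rewrite subr_ge0.
by apply: (psumr_eq0P ge0) => //; rewrite sumrB eqFG subrr.
Qed.

Lemma odd_gap_ge0 (k s : int) :
  ~~ (2 %| k)%Z -> ~~ (2 %| s)%Z -> 0 <= (s - k) * (s - (k + 2)).
Proof.
move=> ko so; have : (s <= k) || (k + 2 <= s) by lia.
by case/orP => ?; nia.
Qed.

Lemma sumr_ord_const (n : nat) (c : int) : \sum_(i < n) c = n%:Z * c.
Proof. by rewrite sumr_const card_ord -mulr_natl natz. Qed.

Definition row_sum (m n : nat) (A : 'M[int]_(m, n)) (i : 'I_m) : int :=
  \sum_j A i j.

Section ConferenceMatrix.
Variables (n : nat) (W : 'M[int]_n).
Hypothesis hW : conference_matrix W.

Local Notation rowsum := (row_sum W).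

Lemma mulmx_ones i : (W *m ones n) i 0 = rowsum i.
Proof. by rewrite mxE; apply: eq_bigr => j _; rewrite mxE mulr1. Qed.

Lemma conference_gram i j :
  \sum_l W i l * W j l = (n%:Z - 1) *+ (i == j).
Proof.
have [_ _ /matrixP/(_ i j)] := hW; rewrite !mxE => <-.
by apply: eq_bigr => l _; rewrite mxE.
Qed.

(** Off-diagonal squares are at most 1, yet each row has squared norm [n - 1], the number of its
    off-diagonal positions; so none of them vanishes. *)
Lemma conference_sqr i j : W i j ^+ 2 = (i != j)%:Z.
Proof.
have [We W0 _] := hW; move: j; apply: psumr_le_eq => [l|].
  have := We i l; have [->|_] := eqVneq i l; first by rewrite W0.
  by rewrite !inE => /or3P[]/eqP->.
under eq_bigr do rewrite expr2.
rewrite conference_gram eqxx mulr1n (bigD1 i) //= eqxx add0r.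
under eq_bigr => l li do rewrite eq_sym li.
(* The count is the truncated [n.-1]; the index [i] rules out [n = 0]. *)
by rewrite sumr_const cardC1 card_ord natz; case: (n) i => [[]|m _] //; lia.
Qed.

Lemma conference_dvd_sqrB i j : (2 %| W i j ^+ 2 - W i j)%Z.
Proof. by have [+ _ _] := hW; move/(_ i j); rewrite !inE => /or3P[]/eqP->. Qed.

(* Two distinct rows are orthogonal and have exactly [n - 2] common nonzero
   positions, each contributing an odd product. *)
Lemma conference_even : (2 <= n)%N -> ~~ odd n.
Proof.
move=> n2; have [i0 [i1 i01]] : exists i0 i1 : 'I_n, i0 != i1.
  by exists (Ordinal (ltnW n2)), (Ordinal n2).
have dvd : (2 %| \sum_l ((i0 != l)%:Z * (i1 != l)%:Z - W i0 l * W i1 l))%Z.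
  apply: rpred_sum => l _; rewrite -!conference_sqr.
  have := conference_dvd_sqrB i0 l; have := conference_dvd_sqrB i1 l.
  move=> /dvdzP[a ha] /dvdzP[b hb]; apply/dvdzP.
  (* With [x], [y] the two entries, [x^2 y^2 - x y = x^2 (y^2 - y) + (x^2 - x) y]. *)
  by exists (W i0 l ^+ 2 * a + b * W i1 l); nia.
move: dvd; rewrite sumrB conference_gram (negPf i01) mulr0n subr0.
rewrite (bigD1 i0) //= (bigD1 i1) 1?eq_sym //= !eqxx mul0r add0r mulr0 add0r.
rewrite (eq_bigr (fun=> 1)) => [|l /andP[l0 l1]]; last first.
  by rewrite !(eq_sym _ l) l0 l1.
rewrite sumr_const natz.
have := cardC [set i0; i1]; rewrite cards2 i01 card_ord.
rewrite (eq_card (A := [predC _]) (B := fun l => (l != i0) && (l != i1))).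
  by lia.
by move=> l; rewrite !inE negb_or.
Qed.

(** Modulo 2 each entry equals its square, so the row sum is congruent to the squared norm [n - 1],
    which is odd. *)
Lemma rowsum_odd i : (2 <= n)%N -> ~~ (2 %| rowsum i)%Z.
Proof.
move=> n2; have := conference_even n2.
have : (2 %| \sum_j (W i j * W i j - W i j))%Z.
  by apply: rpred_sum => j _; rewrite -expr2 conference_dvd_sqrB.
by rewrite sumrB conference_gram eqxx mulr1n -/(rowsum i); lia.
Qed.

Lemma sum_rowsum_sqr :
  (2 <= n)%N -> \sum_i rowsum i ^+ 2 = n%:Z * (n%:Z - 1).
Proof.
move=> n2; have [_ _ WWT] := hW.
have WTW : W^T *m W = (n%:Z - 1)%:M by apply: trmx_mulmx_scalar => //; lia.
(* The sum of squares is the squared norm of [W *m ones n], which brings in [W^T *m W] rather than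
   [W *m W^T]. *)
have /matrixP/(_ 0 0) : (W *m ones n)^T *m (W *m ones n)
    = (n%:Z - 1) *: ((ones n)^T *m ones n).
  by rewrite trmx_mul -mulmxA [W^T *m _]mulmxA WTW mul_scalar_mx -scalemxAr.
rewrite !mxE.
under eq_bigr do rewrite mxE mulmx_ones -expr2.
move=> ->; under eq_bigr do rewrite !mxE mulr1.
by rewrite sumr_ord_const; ring.
Qed.

Lemma sum_gap (k : int) : (2 <= n)%N ->
  \sum_i (rowsum i - k) * (rowsum i - (k + 2)) =
    n%:Z * (k ^+ 2 + 2 * k + n%:Z - 1) - 2 * (k + 1) * excess W.
Proof.
move=> n2.
rewrite (eq_bigr (fun i => rowsum i ^+ 2 - (2 * k + 2) * rowsum i
   + k * (k + 2))) => [|i _]; last by ring.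
rewrite big_split sumrB /= sum_rowsum_sqr // -mulr_sumr sumr_ord_const.
by rewrite /excess /row_sum; ring.
Qed.

(** Clearing the denominator keeps the bound in [int]; the division takes place only in the final
    theorem. *)
Lemma excess_le (k : int) : (2 <= n)%N -> ~~ (2 %| k)%Z ->
  2 * (k + 1) * excess W <= n%:Z * (k ^+ 2 + 2 * k + n%:Z - 1).
Proof.
move=> n2 ko; rewrite -subr_ge0 -sum_gap //; apply: sumr_ge0 => i _.
by rewrite odd_gap_ge0 ?rowsum_odd.
Qed.

Lemma excess_eqP (k : int) : (2 <= n)%N -> ~~ (2 %| k)%Z ->
  2 * (k + 1) * excess W = n%:Z * (k ^+ 2 + 2 * k + n%:Z - 1)
  <-> forall i, rowsum i = k \/ rowsum i = k + 2.
Proof.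
move=> n2 ko; have gap0 i : true -> 0 <= (rowsum i - k) * (rowsum i - (k + 2)).
  by rewrite odd_gap_ge0 ?rowsum_odd.
split=> [eqE i | hs].
  have /eqP : (rowsum i - k) * (rowsum i - (k + 2)) = 0.
    by apply: (psumr_eq0P gap0); rewrite // sum_gap // eqE subrr.
  by rewrite mulf_eq0 !subr_eq0 => /orP[]/eqP; [left|right].
apply/esym/eqP; rewrite -subr_eq0 -sum_gap // big1 // => i _.
by case: (hs i) => ->; rewrite subrr ?mul0r ?mulr0.
Qed.

(** Used to show that both values occur in case (ii): a single common row sum would make [n - 1] its
    square. *)
Lemma rowsum_const (c : int) :
  (2 <= n)%N -> (forall i, rowsum i = c) -> n%:Z - 1 = c ^+ 2.
Proof.
move=> n2 hc; have := sum_rowsum_sqr n2.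
under eq_bigr do rewrite hc.
by rewrite sumr_ord_const => /mulfI->; lia.
Qed.

(** As [k] is nonnegative, every squared row sum is at least [k ^+ 2]; the totals agree, so no term
    can exceed it. *)
Lemma rowsum_eq_min (k : int) : (2 <= n)%N -> 0 <= k -> n%:Z - 1 = k ^+ 2 ->
  (forall i, k <= rowsum i) -> forall i, rowsum i = k.
Proof.
move=> n2 k0 nk hs i.
have /(_ i) : forall i, k ^+ 2 = rowsum i ^+ 2.
  apply: psumr_le_eq => [j|]; first by have := hs j; nia.
  by rewrite sum_rowsum_sqr // sumr_ord_const nk.
by have := hs i; nia.
Qed.

Lemma rowsum_dichotomy (k : int) : (2 <= n)%N -> ~~ (2 %| k)%Z -> 0 < k ->
    k ^+ 2 <= n%:Z - 1 < (k + 2) ^+ 2 ->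
  (forall i, rowsum i = k \/ rowsum i = k + 2) <->
  (perfect_square (n - 1) /\ W *m ones n = k *: ones n)
  \/ (~ perfect_square (n - 1)
      /\ forall x : int,
           (exists i : 'I_n, (W *m ones n) i 0 = x) <-> (x = k \/ x = k + 2)).
Proof.
move=> n2 ko k0 /andP[kn nk]; split=> [hs|[[_ /matrixP Wk] i|[_ Wx] i]]; last 2 first.
- by left; rewrite -mulmx_ones Wk !mxE mulr1.
- by apply/Wx; exists i; rewrite mulmx_ones.
have sqP : perfect_square (n - 1) -> n%:Z - 1 = k ^+ 2.
  move=> [r nr]; have := conference_even n2.
  have nr' : n%:Z - 1 = r%:Z * r%:Z by move: nr; rewrite -mulnn; lia.
  have kr : k <= r%:Z < k + 2 by nia.
  have [rk|rk] : r%:Z = k \/ r%:Z = k + 1 by lia.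
    by rewrite nr' rk expr2.
  (* The root [k + 1] is even, which would make [n - 1] even, while [n] is even. *)
  have [q kq] : exists q, k = 2 * q + 1 by exists (k %/ 2)%Z; lia.
  have : n%:Z - 1 = 2 * (2 * (q + 1) * (q + 1)) by rewrite nr' rk kq; ring.
  by lia.
have [nk2|nk2] := eqVneq (n%:Z - 1) (k ^+ 2); [left|right].
  split; first by exists `|k|%N; rewrite -mulnn; nia.
  have sk : forall i, rowsum i = k.
    by apply: rowsum_eq_min => // [|i]; [exact: ltW | case: (hs i) => ->; lia].
  by apply/matrixP => i j; rewrite ord1 mulmx_ones sk !mxE mulr1.
split=> [/sqP /eqP|x]; first by rewrite (negPf nk2).
split=> [[i <-]|]; first by rewrite mulmx_ones.
(* If [k] is missed, [n - 1] is [(k + 2) ^+ 2], beyond the strict upper bound; if [k + 2] is missed,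
   it is [k ^+ 2], excluded in this branch. *)
have [/existsP[i /eqP ik]|/existsPn nk1] := boolP [exists i, rowsum i == k]; last first.
  have /rowsum_const -/(_ n2) : forall i, rowsum i = k + 2.
    by move=> i; case: (hs i) => // /eqP; rewrite (negPf (nk1 i)).
  by lia.
have [/existsP[j /eqP jk]|/existsPn nk3] := boolP [exists i, rowsum i == k + 2]; last first.
  have /rowsum_const -/(_ n2) /eqP : forall i, rowsum i = k.
    by move=> j; case: (hs j) => // /eqP; rewrite (negPf (nk3 j)).
  by rewrite (negPf nk2).
by case=> ->; [exists i | exists j]; rewrite mulmx_ones.
Qed.

End ConferenceMatrix.

Theorem proposition1p1 (R : rcfType) (n : nat) (W : 'M[int]_n) (k : int)
  (hn : (2 <= n)%N)
  (hW : conference_matrix W)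
  (hk_odd : ~~ (2 %| k)%Z)
  (hk : k%:~R <= Num.sqrt (n%:R - 1 : R) < k%:~R + 2) :
  let bound : R :=
    n%:R * (k%:~R ^+ 2 + 2 * k%:~R + n%:R - 1) / (2 * (k%:~R + 1)) in
  (excess W)%:~R <= bound
  /\ ((excess W)%:~R = bound <->
        (perfect_square (n - 1) /\ W *m ones n = k *: ones n)
        \/ (~ perfect_square (n - 1)
            /\ forall x : int,
                 (exists i : 'I_n, (W *m ones n) i 0 = x) <->
                 (x = k \/ x = k + 2))).
Proof.
have [k0 kn] : 0 < k /\ k ^+ 2 <= n%:Z - 1 < (k + 2) ^+ 2.
  have n1 : 1 <= n%:R - 1 :> R by rewrite lerBrDr (ler_nat R 2).
  case/andP: hk; set r := Num.sqrt _ => kr rk.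
  have r1 : 1 <= r by rewrite -sqrtr1 ler_sqrt // (le_trans ler01).
  have rr : r ^+ 2 = n%:R - 1 by rewrite sqr_sqrtr // (le_trans ler01).
  have k0 : 0 < k.
    (* The root is at least 1 and below [k + 2], so [k] exceeds -1; oddness then excludes 0. *)
    suff : -1 < k by lia.
    by rewrite -(ltr_int R) rmorphN1; lra.
  have k0R : 0 < k%:~R :> R by rewrite ltr0z.
  split=> //; rewrite -(ler_int R) -(ltr_int R) !(rmorphXn, rmorphB, rmorphD) /=.
  by rewrite -pmulrn -rr; apply/andP; split; nra.
have e0 : 0 < 2 * (k%:~R + 1) :> R by rewrite mulr_gt0 // ltr_wpDl // ler0z ltW.
have lhsE : (excess W)%:~R * (2 * (k%:~R + 1)) = (2 * (k + 1) * excess W)%:~R :> R.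
  by rewrite !rmorphM rmorphD /=; ring.
have rhsE : n%:R * (k%:~R ^+ 2 + 2 * k%:~R + n%:R - 1)
    = (n%:Z * (k ^+ 2 + 2 * k + n%:Z - 1))%:~R :> R.
  by rewrite rmorphM rmorphB !rmorphD rmorphXn rmorphM /= -!pmulrn.
split; first by rewrite ler_pdivlMr // lhsE rhsE ler_int excess_le.
rewrite -rowsum_dichotomy // -excess_eqP //.
have e_neq0 := lt0r_neq0 e0.
split=> [eqE|/(congr1 (intr : int -> R))].
  by apply: (intr_inj (R := R)); rewrite -lhsE -rhsE eqE divfK.
by rewrite -lhsE -rhsE => <-; rewrite mulfK.
Qed.
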